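(* Let $n$ be a positive integer and let $u$ be a real number with $-\infty<u<1$. The eigenvalues of the $2^n\times2^n$ matrix $\zeta_n(u)$ are $$\lambda_d=\frac{1}{2^n}\frac{\Gamma\left(\frac52-u\right)\,\Gamma(2+n-d-u)\,\Gamma(1+d-u)}{\Gamma\left(\frac52+\frac n2-u\right)\,\Gamma\left(2+\frac n2-u\right)\,\Gamma(1-u)},\qquad d=0,1,\dots,\left\lfloor\frac n2\right\rfloor,$$ with respective multiplicities $$\frac{(n-2d+1)^2}{n+1}\binom{n+1}{d}.$$
   Context: $[n]=\{1,\dots,n\}$; rows and columns of $2^n\times2^n$ matrices are indexed by subsets of $[n]$. For $I,J\subseteq[n]$ put $n_{\in\in}=|I\cap J|$, $n_{\notin\notin}=|[n]\setminus(I\cup J)|$, $n_{\notin\in}=|J\setminus I|$, $n_{\in\notin}=|I\setminus J|$; $\delta_{i,j}$ is the Kronecker delta. The matrix $\zeta_n(u)=(Z_{IJ})_{I,J\subseteq[n]}$ has entries $$Z_{IJ}=\delta_{n_{\notin\in},n_{\in\notin}}\Big(\tfrac{n-n_{\in\in}-n_{\notin\notin}}{2}\Big)!\;\frac{1}{2^n}\,\frac{\Gamma\left(\frac52-u\right)\,\Gamma\left(2+\frac n2+\frac{n_{\in\in}}2-\frac{n_{\notin\notin}}2-u\right)\,\Gamma\left(2+\frac n2+\frac{n_{\notin\notin}}2-\frac{n_{\in\in}}2-u\right)}{\Gamma\left(\frac52+\frac n2-u\right)\,\Gamma\left(2+\frac n2-u\right)\,\Gamma\left(2+\frac n2-\frac{n_{\in\in}}2-\frac{n_{\notin\notin}}2-u\right)}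 .$$ (This is the average of the $n$-fold tensor power of $\rho=\frac12\begin{pmatrix}1+z & x-iy \\ x+iy & 1-z\end{pmatrix}$ over the unit ball $x^2+y^2+z^2\le1$ with respect to the probability density $\frac{\Gamma(5/2-u)}{\pi^{3/2}\Gamma(1-u)(1-x^2-y^2-z^2)^u}$.) *)

(* Defs.v *)
From HB Require Import structures.
From mathcomp Require Import all_boot all_order all_algebra.
From mathcomp Require Import all_classical all_reals all_analysis.
Set Implicit Arguments.
Unset Strict Implicit.
Unset Printing Implicit Defensive.
Import Order.TTheory GRing.Theory Num.Theory.
Import numFieldNormedType.Exports.
Local Open Scope classical_set_scope.
Local Open Scope ring_scope.

(* Euler's integral converges exactly for x > 0; elsewhere this total function
   is not the meromorphic continuation of Gamma.  For u < 1 every argument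
   occurring in [zeta_entry], [lambda] below is positive: in particular
   n - #|I :&: J| - #|~: (I :|: J)| is the size of the symmetric difference
   of I and J, and lambda is only used for d <= n. *)
Definition Gamma {R : realType} (x : R) : R :=
  \int[lebesgue_measure]_(t in `]0, +oo[) (t `^ (x - 1) * expR (- t)).

(* I and J are subsets of 'I_n = {0, ..., n-1}.  The halving in the factorial
   is exact whenever the Kronecker delta is nonzero, the symmetric difference
   then having even size; the natural number subtractions never truncate. *)
Definition zeta_entry {R : realType} (n : nat) (u : R) (I J : {set 'I_n}) : R :=
  let nii := #|I :&: J| in
  let noo := #|~: (I :|: J)| in
  let noi := #|J :\: I| in
  let nio := #|I :\: J| in
  (noi == nio)%:R * (((n - nii - noo)./2)`!)%:R * (1 / 2 ^+ n)
  * (Gamma (5 / 2 - u)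
     * Gamma (2 + n%:R / 2 + nii%:R / 2 - noo%:R / 2 - u)
     * Gamma (2 + n%:R / 2 + noo%:R / 2 - nii%:R / 2 - u))
  / (Gamma (5 / 2 + n%:R / 2 - u)
     * Gamma (2 + n%:R / 2 - u)
     * Gamma (2 + n%:R / 2 - nii%:R / 2 - noo%:R / 2 - u)).

(* The size #|{set 'I_n}| equals 2 ^ n; [enum_val] turns row
   and column indices into the subsets they stand for. *)
Definition zeta {R : realType} (n : nat) (u : R) : 'M[R]_#|{set 'I_n}| :=
  \matrix_(i, j) zeta_entry u (enum_val i) (enum_val j).

Definition lambda {R : realType} (n : nat) (u : R) (d : nat) : R :=
  1 / 2 ^+ n
  * (Gamma (5 / 2 - u) * Gamma (2 + n%:R - d%:R - u) * Gamma (1 + d%:R - u))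
  / (Gamma (5 / 2 + n%:R / 2 - u) * Gamma (2 + n%:R / 2 - u) * Gamma (1 - u)).

Definition multiplicity (n d : nat) : rat :=
  (n%:R - 2 * d%:R + 1) ^+ 2 / (n%:R + 1) * 'C(n.+1, d)%:R.

(* Main.v *)
Require Import Defs.
From mathcomp Require Import all_boot all_order all_algebra.
From mathcomp Require Import all_classical all_reals all_analysis.
From mathcomp Require Import measurable_realfun.
From mathcomp Require Import ring lra zify.
Import Order.TTheory GRing.Theory Num.Theory.
Local Open Scope ring_scope.

(** Put a = 1 - u.  By the functional equation of Gamma, every quotient of
    Gamma values in the matrix collapses, and zeta n u becomes a kernel on pairs
    of subsets I, J with the same number s of elements, with value c_s z_k,
    where k = #|I :\: J|, z_k = k! / (a (a+1) ... (a+k)), and c_s is a weight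
    with c_(s+1) (a+n-s) = c_s (a+1+s) ([zeta_invariant_mx]).

    The matrix is an average of tensor powers over a rotation invariant law, so
    it must commute with SU(2), that is with sl_2 acting on functions on
    subsets.  Let U be the raising operator, which sends a subset to the sum of
    the subsets that cover it, D its transpose, and L the diagonal matrix of
    cardinals.  Then U D - D U = n - 2 L ([up_down_commutator]), and U commutes
    with the kernel by a computation that uses only the recurrences of c_s and
    z_k ([up_mx_invariant]).  (All matrices act on row vectors.)

    Let H_d be the space of vectors on level d killed by D.  It has dimension at
    least 'C(n, d) - 'C(n, d-1), since D maps level d to level d-1
    ([rank_lowest_ge]), and the commutator makes U^j injective on H_d for
    d + j <= n - d ([rank_lowest_raise]).  On H_d the indicator of the relation
    #|I :\: J| = k acts as (-1)^k 'C(d, k) ([lowest_distance]); hence the kernel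
    acts there, and on all the H_d U^j, as c_d times the alternating sum of
    'C(d, k) z_k.  As z_k is the integral of t^k (1-t)^(a-1) over [0, 1], that
    sum is the integral of (1-t)^(a+d-1), namely 1 / (a+d)
    ([beta_moment_alternating]).  The scalar c_d / (a+d) is lambda_d.

    So the eigenspace of lambda_d has dimension at least
    (n+1-2d) ('C(n, d) - 'C(n, d-1)).  The lambda_d are strictly decreasing in
    d <= n/2, so these eigenspaces are independent, and the lower bounds add up
    to 2^n ([sum_spectral_dimension]).  Therefore all of them are equalities,
    there is no other eigenvalue, and the matrix is diagonalizable, which gives
    the algebraic multiplicities too ([exhaustive_eigenspaces]).

    The functional equation of Gamma is integration by parts on segments
    [1/(k+1), k+2] that exhaust the half line ([gamma_integralS]). *)

Set Implicit Arguments.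
Unset Strict Implicit.
Unset Printing Implicit Defensive.

(** * Eigenspaces that exhaust the dimension *)

Section LinearAlgebra.
Variable F : fieldType.

Lemma rank_diag_mx_le n (d : 'rV[F]_n) :
  (\rank (diag_mx d) <= #|[pred i | d ord0 i != 0%R]|)%N.
Proof.
have -> : diag_mx d = \sum_(i | d ord0 i != 0) d ord0 i *: delta_mx i i.
  rewrite diag_mx_sum_delta (bigID (fun i => d ord0 i != 0)) /=.
  rewrite [X in _ + X]big1 ?addr0 // => i /negPn/eqP ->.
  by rewrite scale0r.
rewrite -sum1_card.
elim/big_rec2: _ => [|i y p _ IH]; first by rewrite mxrank0.
rewrite (leq_trans (mxrank_add _ _)) // leq_add //.
by rewrite (leq_trans (mxrank_scale _ _)) // mxrank_delta.
Qed.

Lemma rank_diag_mx n (d : 'rV[F]_n) :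
  \rank (diag_mx d) = #|[pred i | d ord0 i != 0%R]|.
Proof.
apply/eqP; rewrite eqn_leq rank_diag_mx_le /=.
pose e := \row_i (d ord0 i == 0)%:R : 'rV[F]_n.
(* The ranks of [diag_mx d] and of the complementary projector [diag_mx e] add
   up to at least [n], so the upper bounds on both of them are sharp. *)
have ru : (n <= \rank (diag_mx d) + \rank (diag_mx e))%N.
  apply: leq_trans (mxrank_add _ _).
  suff /mxrank_unit -> : diag_mx d + diag_mx e \in unitmx by [].
  rewrite -raddfD unitmxE det_diag unitfE; apply/prodf_neq0 => i _.
  rewrite !mxE; have [->|] := eqVneq (d ord0 i) 0; last by rewrite addr0.
  by rewrite add0r oner_eq0.
have re := rank_diag_mx_le e.
have cE : (#|[pred i | d ord0 i != 0%R]| + #|[pred i | e ord0 i != 0%R]| = n)%N.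
  rewrite -[RHS]card_ord -(cardC [pred i | d ord0 i != 0%R]); congr (_ + _)%N.
  apply: eq_card => i; rewrite !inE mxE.
  by case: (d ord0 i == 0); rewrite ?oner_eq0 ?eqxx.
rewrite -(leq_add2r #|[pred i | e ord0 i != 0%R]|) cE (leq_trans ru) //.
by rewrite leq_add2l.
Qed.

Lemma rank_eigenspace_diag n (d : 'rV[F]_n) a :
  \rank (eigenspace (diag_mx d) a) = #|[pred i | d ord0 i == a]|.
Proof.
rewrite mxrank_ker.
have -> : diag_mx d - a%:M = diag_mx (\row_i (d ord0 i - a)).
  by apply/matrixP => i j; rewrite !mxE -mulrnBl.
rewrite rank_diag_mx -[n in (n - _)%N]card_ord.
rewrite -(cardC [pred i | d ord0 i == a]) addnC; set A := #|predC _|.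
set B := #|[pred i | _ != _]|.
suff -> : B = A by rewrite addKn.
by apply: eq_card => i; rewrite !inE mxE subr_eq0.
Qed.

Lemma mup_prod_XsubC (I : finType) (a : F) (f : I -> F) :
  mup a (\prod_i ('X - (f i)%:P)) = #|[pred i | f i == a]|.
Proof.
rewrite -sum1_card [RHS]big_mkcond /=.
(* [mupM] requires nonzero factors, so this is carried along the induction. *)
pose K (p : {poly F}) m := p != 0 /\ mup a p = m.
suff [] : K (\prod_i ('X - (f i)%:P)) (\sum_i (if f i == a then 1 else 0)%N) by [].
elim/big_rec2: _ => [|i y p _ [p0 IH]].
  by split; rewrite ?oner_eq0 // mupNroot // root1.
split; first by rewrite mulf_neq0 // polyXsubC_eq0.
by rewrite mupM ?polyXsubC_eq0 // IH -['X - _]expr1 mup_XsubCX.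
Qed.

Lemma char_poly_simmx n (P A B : 'M[F]_n) :
  P \in unitmx -> P *m A = B *m P -> char_poly A = char_poly B.
Proof.
move=> Pu PA; pose Q := map_mx polyC P.
have QE : Q *m char_poly_mx A = char_poly_mx B *m Q.
  by rewrite /char_poly_mx mulmxBr mulmxBl -!map_mxM PA scalar_mxC.
have := congr1 determinant QE; rewrite !det_mulmx mulrC; apply: mulIf.
by rewrite det_map_mx polyC_eq0 -unitfE -unitmxE.
Qed.

(** Both multiplicities are invariant under similarity, and for a diagonal
    matrix both count the entries equal to [a]. *)
Lemma diagonalizable_mup n (A : 'M[F]_n) a :
  diagonalizable A -> mup a (char_poly A) = \rank (eigenspace A a).
Proof.
move=> [P Pu /diagonalizable_forPex [d /(simmxP Pu) PA]].
rewrite (char_poly_simmx Pu PA) char_poly_trig ?diag_mx_is_trig //.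
under eq_bigr => i _ do rewrite mxE eqxx mulr1n.
rewrite mup_prod_XsubC -rank_eigenspace_diag !mxrank_ker; congr (_ - _)%N.
have PB : P *m (A - a%:M) = (diag_mx d - a%:M) *m P.
  by rewrite mulmxBr mulmxBl PA scalar_mxC.
rewrite -[LHS](mxrankMfree _ (_ : row_free P)) ?row_free_unit // -PB.
by rewrite eqmxMfull // row_full_unit.
Qed.

Lemma mxdirect_subspaces (I : finType) n (V W : I -> 'M[F]_n) :
  (forall i, W i <= V i)%MS -> mxdirect (\sum_i V i) -> mxdirect (\sum_i W i).
Proof.
move=> WV /mxdirect_sumsP dV; apply/mxdirect_sumsP => i _.
have /= V0 := dV i isT; apply/eqP; rewrite -submx0 -[X in (_ <= X)%MS]V0.
by rewrite capmxS // sumsmxS.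
Qed.

Lemma rank_eigenspaces_le (I : finType) n (A : 'M[F]_n) (mu : I -> F) :
  injective mu -> (\sum_i \rank (eigenspace A (mu i)) <= n)%N.
Proof.
move=> mu_inj; have := @mxdirect_sum_eigenspace F I n A predT mu.
move=> /(_ (in2W mu_inj)) /mxdirectP /= <-; exact: rank_leq_row.
Qed.

(** Distinct eigenvalues have independent eigenspaces, so lower bounds on their
    dimensions that add up to the size of the matrix are all attained, and they
    leave no room for another eigenvalue. *)
Lemma exhaustive_eigenspaces (I : finType) n (A : 'M[F]_n) (mu : I -> F)
    (m : I -> nat) :
    injective mu -> (forall i, m i <= \rank (eigenspace A (mu i)))%N ->
    (\sum_i m i = n)%N ->
  [/\ forall a, eigenvalue A a -> exists i, a = mu i,
      forall i, \rank (eigenspace A (mu i)) = m i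
    & forall i, mup (mu i) (char_poly A) = m i].
Proof.
move=> mu_inj m_le m_sum.
have rk i : \rank (eigenspace A (mu i)) = m i.
  apply/eqP; rewrite eqn_leq m_le andbT.
  have := rank_eigenspaces_le A mu_inj; rewrite -[leqRHS]m_sum.
  rewrite (bigD1 i) //= [leqRHS](bigD1 i) //= => le.
  rewrite -(leq_add2r (\sum_(j | j != i) m j)) (leq_trans _ le) // leq_add2l.
  by apply: leq_sum => j _.
have full : (\sum_i eigenspace A (mu i) :=: 1%:M)%MS.
  apply/eqmxP; rewrite submx1 sub1mx /row_full.
  have := @mxdirect_sum_eigenspace F I n A predT mu.
  move=> /(_ (in2W mu_inj)) /mxdirectP /= ->.
  by rewrite (eq_bigr m) // m_sum.
have dA : diagonalizable A.
  apply/diagonalizablePeigen; exists [seq mu i | i <- enum I].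
    by rewrite map_inj_uniq ?enum_uniq.
  by rewrite big_map big_enum.
split=> // [a aA|i]; last by rewrite diagonalizable_mup ?rk.
have [/existsP[i /eqP]|ne] := boolP [exists i, a == mu i]; first by exists i.
(* A further eigenvalue [a] extends the injective family [mu], and the
   dimensions would then add up to more than [n]. *)
pose mu' o := if o is Some i then mu i else a.
have mu'_inj : injective mu'.
  move=> [i|] [j|] //= e.
  - by rewrite (mu_inj _ _ e).
  - by case/negP: ne; apply/existsP; exists i; rewrite e.
  - by case/negP: ne; apply/existsP; exists j; rewrite e.
have := rank_eigenspaces_le A mu'_inj.
rewrite (bigD1 None) //= (reindex_omap Some id) /=; last by case.
under eq_bigl => i do rewrite eqxx.
rewrite (eq_bigr m) // m_sum -[leqRHS]add0n leq_add2r leqn0.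
by rewrite mxrank_eq0 => a0; case/negP: aA.
Qed.

End LinearAlgebra.

(** * Dimensions: ballot numbers *)

Section BinomialGaps.

(** The dimension of the lowest weight space on level [d <= n./2]: a ballot
    number. *)
Definition binomial_gap n d :=
  if d is e.+1 then ('C(n, d) - 'C(n, e))%N else 1%N.

Lemma ltn_binomial n e : (e < n./2)%N -> ('C(n, e) < 'C(n, e.+1))%N.
Proof.
move=> en; rewrite -(ltn_pmul2l (ltn0Sn e)) mul_bin_left ltn_pmul2r ?bin_gt0; lia.
Qed.

Lemma sum_binomial_gap n e : (e <= n./2)%N ->
  (\sum_(0 <= d < e.+1) binomial_gap n d = 'C(n, e))%N.
Proof.
elim: e => [_|e IH en]; first by rewrite big_nat1 bin0.
by rewrite big_nat_recr //= IH ?(ltnW en) // subnKC // ltnW // ltn_binomial.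
Qed.

(** A lowest weight vector on level [d] is raised to the [n + 1 - 2 d] levels
    [d <= s <= n - d].  Exchanging the sums, level [s] receives the gaps of all
    [d <= minn s (n - s)], which telescope to ['C(n, s)]. *)
Lemma sum_spectral_dimension n :
  (\sum_(d < n./2.+1) (n.+1 - d.*2) * binomial_gap n d = 2 ^ n)%N.
Proof.
transitivity (\sum_(0 <= d < n./2.+1) \sum_(0 <= s < n.+1)
    (if (d <= s) && (s < n.+1 - d) then binomial_gap n d else 0))%N.
  rewrite big_mkord; apply: eq_bigr => d _; rewrite -big_mkcond.
  rewrite -(@big_nat_widen _ _ _ 0 (n.+1 - d) n.+1 (fun s => d <= s)%N) ?leq_subr //.
  rewrite -(@big_nat_widenl _ _ _ d 0 _ predT) // sum_nat_const_nat.
  by rewrite -addnn subnDA.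
rewrite exchange_big /=.
transitivity (\sum_(0 <= s < n.+1) 'C(n, s))%N; last first.
  rewrite big_mkord -[2%N]/(1 + 1)%N expnDn.
  by apply: eq_bigr => i _; rewrite !exp1n !muln1.
apply: eq_big_nat => s /andP[_ sn]; rewrite -big_mkcond.
have [e [en eE Ce]] : exists e,
    [/\ (e <= n./2)%N, forall d, ((d <= s) && (s < n.+1 - d) = (d < e.+1))%N
      & 'C(n, s) = 'C(n, e)].
  have [le|gt] := leqP s n./2; first by exists s; split => // d; lia.
  by exists (n - s)%N; split; [lia | move=> d; lia | rewrite bin_sub].
rewrite Ce -sum_binomial_gap // (@big_nat_widen _ _ _ 0 e.+1 n./2.+1) //.
by apply: eq_bigl => d; rewrite eE.
Qed.

(** The identity [e.+1 * 'C(n, e.+1) = (n - e) * 'C(n, e)] expresses both sides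
    for [d = e.+1] in terms of one binomial coefficient. *)
Lemma spectral_dimensionE n d : (d <= n./2)%N ->
  ((n.+1 - d.*2) * binomial_gap n d)%:R =
  (n%:R - 2 * d%:R + 1) ^+ 2 / (n%:R + 1) * 'C(n.+1, d)%:R :> rat.
Proof.
move=> dn; have n1 : n%:R + 1 != 0 :> rat by rewrite natr1 pnatr_eq0.
rewrite natrM natrB; last lia.
rewrite -mul2n natrM -natr1; case: d dn => [|e] en /=.
  by rewrite bin0; field.
rewrite natrB; last by rewrite ltnW // ltn_binomial.
have := congr1 (fun m => m%:R : rat) (mul_bin_left n e).
rewrite binS natrD !natrM natrB -?natr1; last lia.
set x := 'C(n, e.+1)%:R; set y := 'C(n, e)%:R => xy.
apply: (mulIf n1).
transitivity ((n%:R - 2 * (e%:R + 1) + 1) ^+ 2 * (x + y)); last by field.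
rewrite add0r -[1 + 1]/2; apply/eqP; rewrite -subr_eq0; apply/eqP.
transitivity (2 * (n%:R - 2 * e%:R - 1) *
  ((e%:R + 1) * x - (n%:R - e%:R) * y)); first by ring.
by rewrite xy subrr mulr0.
Qed.

End BinomialGaps.

(** * Moments of the beta law *)

Section BetaMoments.
Variable F : realFieldType.

(** The integral of [t ^ k * (1 - t) ^ (a - 1)] over [[0, 1]]. *)
Definition beta_moment (a : F) (k : nat) : F :=
  k`!%:R / \prod_(i < k.+1) (a + i%:R).

Lemma rising_neq0 (a : F) k : 0 < a -> \prod_(i < k) (a + i%:R) != 0.
Proof.
by move=> a0; apply/prodf_neq0 => i _; rewrite gt_eqF // ltr_wpDr.
Qed.

Lemma beta_momentS (a : F) k : 0 < a ->
  k.+1%:R * beta_moment a k = (a + k.+1%:R) * beta_moment a k.+1.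
Proof.
move=> a0; rewrite /beta_moment [in RHS]big_ord_recr /= factS natrM.
have := rising_neq0 k.+1 a0; set p := \prod_(i < _) _ => p0.
have ak : a + k.+1%:R != 0 by rewrite gt_eqF // ltr_wpDr.
by field; rewrite p0 nat1r ak.
Qed.

(** Under the integral sign, [t ^ k - t ^ k.+1 = t ^ k * (1 - t)]. *)
Lemma beta_moment_diff (a : F) k : 0 < a ->
  beta_moment a k - beta_moment a k.+1 = beta_moment (a + 1) k.
Proof.
move=> a0.
have ak : a + k.+1%:R != 0 by rewrite gt_eqF // ltr_wpDr.
have -> : beta_moment a k.+1 = k.+1%:R * beta_moment a k / (a + k.+1%:R).
  by rewrite beta_momentS // mulrC mulKf.
rewrite /beta_moment big_ord_recl [in RHS]big_ord_recr /= addr0.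
have -> : \prod_(i < k) (a + (bump 0 i)%:R) = \prod_(i < k) (a + 1 + i%:R).
  by apply: eq_bigr => i _; rewrite /bump add1n -nat1r addrA.
have a1 : 0 < a + 1 by rewrite ltr_wpDr.
have := rising_neq0 k a1; set p := \prod_(i < _) _ => p0.
move: ak; rewrite -nat1r addrA => ak.
by field; rewrite p0 ak gt_eqF.
Qed.

(** The binomial formula for [(1 - t) ^ d] under the integral sign, proved by
    iterating [beta_moment_diff].  The terms with [k > d] vanish; leaving the
    upper bound [N] free allows Pascal's rule to be applied termwise. *)
Lemma beta_moment_alternating (a : F) N d m : 0 < a -> (d < N)%N ->
  \sum_(k < N) (-1) ^+ k * 'C(d, k)%:R * beta_moment a (m + k) =
  beta_moment (a + d%:R) m.
Proof.
move=> a0; elim: d N m => [|d IH] [//|N] m dN.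
  rewrite big_ord_recl big1 /= => [|i _]; last by rewrite mulr0 mul0r.
  by rewrite addn0 !addr0 !mul1r.
have E : beta_moment (a + d.+1%:R) m =
    beta_moment (a + d%:R) m - beta_moment (a + d%:R) m.+1.
  by rewrite beta_moment_diff ?ltr_wpDr // -natr1 addrA.
rewrite {}E -(IH N.+1) ?(ltnW dN) // -(IH N) //.
rewrite !big_ord_recl /= !bin0 -addrA; congr (_ + _).
rewrite -sumrB; apply: eq_bigr => i _.
by rewrite /bump add1n addnS binS natrD exprS; ring.
Qed.

End BetaMoments.

(** * Raising and lowering subsets *)

Section Kernels.
Import boot.finset.
Variables (F : realFieldType) (T : finType).
Local Notation X := {set T}.
Local Notation n := #|T|.

(** Matrices indexed by subsets are handled through functions of two subsets, so
    that products become sums over subsets. *)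
Definition kernel_mx (k : X -> X -> F) : 'M[F]_#|{set T}| :=
  \matrix_(i, j) k (enum_val i) (enum_val j).

Lemma eq_kernel_mx k l : (forall I J, k I J = l I J) -> kernel_mx k = kernel_mx l.
Proof. by move=> kl; apply/matrixP => i j; rewrite !mxE kl. Qed.

Lemma kernel_mxM k l :
  kernel_mx k *m kernel_mx l = kernel_mx (fun I J => \sum_K k I K * l K J).
Proof.
apply/matrixP => i j; rewrite !mxE.
rewrite (reindex _ (onW_bij _ (enum_val_bij X))) /=.
by apply: eq_bigr => m _; rewrite !mxE.
Qed.

Lemma kernel_mx1 : kernel_mx (fun I J => (I == J)%:R) = 1%:M.
Proof.
by apply/matrixP => i j; rewrite !mxE (inj_eq enum_val_inj).
Qed.

(** The indicator of [J] being [I] with one more element, written as a sum so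
    that sums over the subsets covering [I] become sums over elements. *)
Definition covers (I J : X) : F := \sum_(x | x \notin I) (J == x |: I)%:R.

Lemma coversEr I J : covers I J = \sum_(x in J) (I == J :\ x)%:R.
Proof.
rewrite /covers big_mkcond [RHS]big_mkcond; apply: eq_bigr => x _ /=.
have [xI|xI] := boolP (x \in I); have [xJ|xJ] := boolP (x \in J) => //=.
- suff /negPf -> : I != J :\ x by [].
  by apply: contraTneq xI => ->; rewrite !inE eqxx.
- congr (_ %:R); congr nat_of_bool; apply/eqP/eqP => ->.
    by rewrite setU1K.
  by rewrite setD1K.
- suff /negPf -> : J != x |: I by [].
  by apply: contraNneq xJ => ->; rewrite !inE eqxx.
Qed.

Lemma sum_pick (f : X -> F) A : \sum_K (K == A)%:R * f K = f A.
Proof.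
rewrite (bigD1 A) //= eqxx mul1r big1 ?addr0 // => K /negPf ->.
by rewrite mul0r.
Qed.

Lemma sum_covers f I : \sum_K covers I K * f K = \sum_(x | x \notin I) f (x |: I).
Proof.
under eq_bigr => K _ do rewrite /covers mulr_suml.
by rewrite exchange_big /=; apply: eq_bigr => x _; rewrite sum_pick.
Qed.

Lemma sum_covers_r f J : \sum_K covers K J * f K = \sum_(x in J) f (J :\ x).
Proof.
under eq_bigr => K _ do rewrite coversEr mulr_suml.
by rewrite exchange_big /=; apply: eq_bigr => x _; rewrite sum_pick.
Qed.

Definition up_mx := kernel_mx covers.
Definition down_mx := kernel_mx (fun I J => covers J I).
Definition level_mx : 'M[F]_#|{set T}| :=
  diag_mx (\row_i #|(enum_val i : {set T})|%:R).
Local Notation U := up_mx.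
Local Notation D := down_mx.
Local Notation L := level_mx.

Lemma covers_card I J : covers I J != 0 -> #|J| = #|I|.+1.
Proof.
apply: contraNeq => IJ; apply/eqP; apply: big1 => x xI.
case: eqP => // e; case/eqP: IJ.
by rewrite e cardsU1 xI.
Qed.

Lemma up_mx_level : U *m L = L *m U + U.
Proof.
apply/matrixP => i j; rewrite mul_mx_diag mul_diag_mx !mxE.
set I := enum_val i; set J := enum_val j.
have [->|/covers_card ->] := eqVneq (covers I J) 0; first by ring.
by rewrite -natr1; ring.
Qed.

Lemma down_mx_level : D *m L = L *m D - D.
Proof.
apply/matrixP => i j; rewrite mul_mx_diag mul_diag_mx !mxE.
set I := enum_val i; set J := enum_val j.
have [->|/covers_card ->] := eqVneq (covers J I) 0; first by ring.
by rewrite -natr1; ring.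
Qed.

(** Adding [x] and removing [y] commute when [x != y], so only the terms with
    [x = y] survive in the difference: one for each element outside [I] in
    [U *m D], one for each element of [I] in [D *m U]. *)
Lemma up_down_commutator : U *m D = D *m U + n%:R%:M - 2 *: L.
Proof.
have -> : L = kernel_mx (fun I J => (I == J)%:R * #|I|%:R).
  apply/matrixP => i j; rewrite !mxE (inj_eq enum_val_inj).
  by case: eqP => _; rewrite ?mul1r ?mul0r.
rewrite -scalemx1 -kernel_mx1 /U /D !kernel_mxM.
apply/matrixP => i j; rewrite !mxE.
set I := enum_val i; set J := enum_val j.
rewrite (sum_covers (covers J)) (sum_covers_r (fun K => covers K J)).
pose S := \sum_(x | x \notin I) \sum_(y in I) (J == (x |: I) :\ y)%:R : F.
have -> : \sum_(x | x \notin I) covers J (x |: I) =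
          (n%:R - #|I|%:R) * (I == J)%:R + S.
  have -> : (n%:R - #|I|%:R) * (I == J)%:R =
            \sum_(x | x \notin I) (I == J)%:R :> F.
    rewrite sumr_const -natrB ?max_card // mulr_natl -(cardC [in I]) addKn.
    by congr (_ *+ _).
  rewrite -big_split /=; apply: eq_bigr => x xI.
  by rewrite coversEr big_setU1 //= setU1K // eq_sym.
have -> : \sum_(x in I) covers (I :\ x) J = #|I|%:R * (I == J)%:R + S.
  rewrite /S exchange_big /= mulr_natl -sumr_const -big_split /=.
  apply: eq_bigr => y yI; rewrite /covers (bigD1 y) /=; last by rewrite !inE eqxx.
  rewrite setD1K // eq_sym; congr (_ + _).
  apply: eq_big => x.
    by rewrite !inE; case: eqVneq => [->|_]; rewrite ?yI ?andbT.
  rewrite !inE => /andP[_ xy]; congr ((_ == _)%:R).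
  apply/setP => z; rewrite !inE; case: (eqVneq z y) => [->|//].
  by rewrite eq_sym (negPf xy).
by ring.
Qed.

(** Removing [y] from [I] leaves the difference with [J] unchanged if [y] is in
    [J], and lowers its cardinal by one otherwise. *)
Lemma sum_setD_remove (f : nat -> F) (I J : X) :
  \sum_(y in I) f #|(I :\ y) :\: J| =
  #|I :&: J|%:R * f #|I :\: J| + #|I :\: J|%:R * f #|I :\: J|.-1.
Proof.
rewrite (big_setID J) /= !mulr_natl -!sumr_const; congr (_ + _).
  apply: eq_bigr => y; rewrite inE => /andP[_ yJ]; congr (f #|(_ : {set _})|).
  by apply/setP => z; rewrite !inE; case: eqVneq => // ->; rewrite yJ.
apply: eq_bigr => y yIJ; congr f; rewrite setDDl setUC -setDDl.
by rewrite (cardsD1 y (I :\: J)) yIJ.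
Qed.

Lemma sum_setD_add (f : nat -> F) (I J : X) :
  \sum_(x | x \notin I) f #|(x |: I) :\: J| =
  #|J :\: I|%:R * f #|I :\: J| + #|~: (I :|: J)|%:R * f #|I :\: J|.+1.
Proof.
rewrite (eq_bigl [in ~: I]) => [|x]; last by rewrite inE.
rewrite (big_setID J) /= setIC -setDE !mulr_natl -!sumr_const.
congr (_ + _).
  apply: eq_bigr => x; rewrite !inE => /andP[xI xJ]; congr (f #|(_ : {set _})|).
  by apply/setP => z; rewrite !inE; case: eqVneq => // ->; rewrite (negPf xI) xJ.
apply: eq_big => x; first by rewrite !inE negb_or andbC.
rewrite !inE => /andP[xJ xI]; congr f.
have -> : (x |: I) :\: J = x |: (I :\: J).
  by apply/setP => z; rewrite !inE; case: eqVneq => // ->; rewrite xJ.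
by rewrite cardsU1 !inE (negPf xI) andbF.
Qed.

(** Level preserving kernels that commute with all permutations of the ground
    set.  On each level they form the Bose-Mesner algebra of a Johnson scheme,
    and [distance_mx k] is its [k]-th relation. *)
Definition same_card (f : nat -> F) :=
  kernel_mx (fun I J => (#|I| == #|J|)%:R * f #|I :\: J|).

Definition distance_mx k := same_card (fun m => (m == k)%:R).

Lemma distance_mx0 : distance_mx 0 = 1%:M.
Proof.
rewrite -kernel_mx1; apply: eq_kernel_mx => I J; rewrite -natrM mulnb cards_eq0.
congr (nat_of_bool _)%:R; rewrite setD_eq0 eqEcard.
case: (boolP (I \subset J)) => [/subset_leq_card|]; rewrite ?andbF //= andbT.
by rewrite eqn_leq => ->.
Qed.

(** This combination of two consecutive relations factors through [D], hence
    vanishes on the vectors killed by [D]; this is what determines the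
    eigenvalues of [distance_mx] on them. *)
Lemma down_factors_distance k :
  down_mx *m kernel_mx (fun K J => (#|J| == #|K|.+1)%:R * (#|K :\: J| == k)%:R) =
  k.+1%:R *: distance_mx k.+1 + (level_mx - k%:R%:M) *m distance_mx k.
Proof.
rewrite /down_mx kernel_mxM mulmxBl mul_scalar_mx mul_diag_mx.
apply/matrixP => i j; rewrite !mxE.
set I := enum_val i; set J := enum_val j; rewrite sum_covers_r.
have -> : \sum_(x in I) (#|J| == #|I :\ x|.+1)%:R * (#|(I :\ x) :\: J| == k)%:R =
   (#|I| == #|J|)%:R * \sum_(x in I) (#|(I :\ x) :\: J| == k)%:R :> F.
  rewrite mulr_sumr; apply: eq_bigr => x xI.
  by rewrite [in RHS](cardsD1 x I) xI add1n eq_sym.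
rewrite (sum_setD_remove (fun m => (m == k)%:R)).
have -> : #|I|%:R = #|I :&: J|%:R + #|I :\: J|%:R :> F.
  by rewrite -natrD cardsID.
case: (#|I| == #|J|); rewrite ?mul0r ?mulr0 ?subr0 ?addr0 // !mul1r.
case: #|I :\: J| => [|m] /=.
  by case: k => [|k] /=; rewrite ?eqxx ?eqSS /=; ring.
rewrite eqSS; have [->|mk] := eqVneq m k.
  by rewrite (gtn_eqF (ltnSn k)) /=; ring.
by have [<-|_] := eqVneq m.+1 k; rewrite /=; ring.
Qed.

Lemma kernel_mx_scale (f : nat -> F) k :
  kernel_mx (fun I J => f #|I| * k I J) =
  diag_mx (\row_i f #|(enum_val i : X)|) *m kernel_mx k.
Proof. by rewrite mul_diag_mx; apply/matrixP => i j; rewrite !mxE. Qed.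

Lemma same_card_distance f :
  same_card f = \sum_(k < n.+1) f k *: distance_mx k.
Proof.
apply/matrixP => i j; rewrite summxE !mxE.
set I := enum_val i; set J := enum_val j.
have m_lt : (#|I :\: J| < n.+1)%N by rewrite ltnS max_card.
rewrite (bigD1 (Ordinal m_lt)) //= !mxE eqxx mulr1 mulrC big1 ?addr0 // => k kI.
rewrite !mxE -/I -/J; have /negPf -> : #|I :\: J| != k.
  by apply: contraNneq kI => e; apply/eqP/val_inj.
by rewrite !mulr0.
Qed.

Section LowestWeight.
Variables (p d : nat) (V : 'M[F]_(p, #|{set T}|)).
Hypothesis VL : V *m level_mx = d%:R *: V.
Hypothesis VD : V *m down_mx = 0.

Lemma raise_level j : V *m up_mx ^+ j *m level_mx = (d + j)%:R *: (V *m up_mx ^+ j).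
Proof.
elim: j => [|j IH]; first by rewrite expr0 mulmx1 VL addn0.
rewrite exprSr -mulmxE mulmxA -[LHS]mulmxA up_mx_level mulmxDr mulmxA IH.
by rewrite -scalemxAl -{2}[_ *m up_mx]scale1r -scalerDl natr1 addnS.
Qed.

(** Each step from [j] to [j.+1] adds the weight [n - 2 * (d + j)] of the current
    level, by the commutation relation. *)
Lemma lower_raise j : V *m up_mx ^+ j.+1 *m down_mx =
  (j.+1%:R * (n%:R - 2 * d%:R - j%:R)) *: (V *m up_mx ^+ j).
Proof.
elim: j => [|j IH].
  rewrite expr1 -mulmxA up_down_commutator mulmxBr mulmxDr mulmxA VD mul0mx.
  rewrite add0r mul_mx_scalar -scalemxAr VL scalerA -scalerBl expr0 mulmx1.
  by congr (_ *: _); ring.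
rewrite exprSr -mulmxE mulmxA -[LHS]mulmxA up_down_commutator mulmxBr mulmxDr.
rewrite mulmxA IH -scalemxAl -mulmxA mulmxE -exprSr mul_mx_scalar -scalemxAr.
rewrite raise_level scalerA -scalerDl -scalerBl natrD -!natr1.
by congr (_ *: _); ring.
Qed.

(** [down_factors_distance] gives a two-term recurrence in [k], starting from the
    identity matrix at [k = 0]; its solution is the signed binomial coefficient. *)
Lemma lowest_distance k :
  V *m distance_mx k = ((-1) ^+ k * 'C(d, k)%:R) *: V.
Proof.
elim: k => [|k IH]; first by rewrite distance_mx0 mulmx1 expr0 bin0 mul1r scale1r.
have := congr1 (mulmx V) (down_factors_distance k).
rewrite mulmxA VD mul0mx mulmxDr -scalemxAr mulmxA mulmxBr VL mul_mx_scalar.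
rewrite -scalerBl -scalemxAl IH scalerA => /esym/eqP.
rewrite addr_eq0 -scaleNr => /eqP e.
apply: (@scalerI _ _ k.+1%:R); first by rewrite pnatr_eq0.
rewrite e scalerA; congr (_ *: _).
have -> : k.+1%:R * ((-1) ^+ k.+1 * 'C(d, k.+1)%:R) =
          (-1) ^+ k.+1 * (k.+1 * 'C(d, k.+1))%:R :> F by rewrite natrM; ring.
rewrite mul_bin_left natrM exprS.
have [kd|dk] := leqP k d; first by rewrite natrB //; ring.
by rewrite bin_small //; ring.
Qed.

Lemma lowest_same_card (c : nat -> F) f :
  V *m kernel_mx (fun I J => c #|I| * ((#|I| == #|J|)%:R * f #|I :\: J|)) =
  (c d * \sum_(k < n.+1) (-1) ^+ k * 'C(d, k)%:R * f k) *: V.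
Proof.
rewrite kernel_mx_scale mulmxA.
have -> : V *m diag_mx (\row_i c #|(enum_val i : X)|) = c d *: V.
  rewrite mul_mx_diag; apply/matrixP => i j; rewrite !mxE.
  have := congr1 (fun A : 'M[F]_(p, #|{set T}|) => A i j) VL.
  rewrite mul_mx_diag !mxE mulrC => /eqP.
  rewrite -subr_eq0 -mulrBl mulf_eq0 subr_eq0 eqr_nat.
  by case/orP => /eqP ->; rewrite ?mulr0 ?mul0r // mulrC.
rewrite -[kernel_mx _]/(same_card f) same_card_distance -scalemxAl -scalerA.
congr (_ *: _); rewrite mulmx_sumr scaler_suml; apply: eq_bigr => k _.
by rewrite -scalemxAr lowest_distance scalerA mulrC.
Qed.

End LowestWeight.

Lemma rank_level s :
  \rank (eigenspace level_mx s%:R) = 'C(n, s).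
Proof.
rewrite rank_eigenspace_diag -card_draws -sum1dep_card.
rewrite (reindex _ (onW_bij _ (enum_val_bij X))) /= -sum1_card.
by apply: eq_bigl => i; rewrite inE mxE eqr_nat.
Qed.

(** The row space is the space of lowest weight vectors on level [d]. *)
Definition lowest_mx d : 'M[F]_#|{set T}| :=
  (eigenspace level_mx d%:R :&: kermx down_mx)%MS.

Lemma lowest_level d : lowest_mx d *m level_mx = d%:R *: lowest_mx d.
Proof. by apply/eigenspaceP; rewrite capmxSl. Qed.

Lemma lowest_down d : lowest_mx d *m down_mx = 0.
Proof. by apply/sub_kermxP; rewrite capmxSr. Qed.

(** [D] maps level [d] into level [d - 1], so the rank formula bounds its kernel
    from below.  On level [0] it maps into the eigenspace of [level_mx] for
    [-1], which is zero. *)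
Lemma rank_lowest_ge d : (binomial_gap n d <= \rank (lowest_mx d))%N.
Proof.
have down_level (W : 'M[F]_#|{set T}|) b : W *m level_mx = b *: W ->
    W *m down_mx *m level_mx = (b - 1) *: (W *m down_mx).
  move=> WL; rewrite -mulmxA down_mx_level mulmxBr mulmxA WL -scalemxAl.
  by rewrite scalerBl scale1r.
have EL b : eigenspace level_mx b *m level_mx = b *: eigenspace level_mx b.
  exact/eigenspaceP.
have := mxrank_mul_ker (eigenspace level_mx d%:R) down_mx.
rewrite rank_level -/(lowest_mx d); case: d => [|d] /= rk.
  suff E0 : eigenspace level_mx 0 *m down_mx = 0.
    by move: rk; rewrite E0 mxrank0 bin0 add0n => ->.
  apply/eqP; have /eigenspaceP := down_level _ _ (EL 0).
  rewrite sub0r -submx0 => /submx_trans; apply.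
  rewrite submx0 -mxrank_eq0 rank_eigenspace_diag.
  apply/eqP/eq_card0 => i; rewrite !inE mxE.
  by rewrite gt_eqF // (lt_le_trans _ (ler0n _ _)) // ltrN10.
rewrite -rk leq_subLR leq_add2r -rank_level mxrankS //.
apply/eigenspaceP; rewrite (down_level _ _ (EL _)).
by rewrite -natr1 addrK.
Qed.

(** Lowering after raising multiplies by [j.+1 * (n - 2 * d - j)], which is
    nonzero in this range, so raising loses no dimension. *)
Lemma rank_lowest_raise d j : (d.*2 + j <= n)%N ->
  \rank (lowest_mx d *m up_mx ^+ j) = \rank (lowest_mx d).
Proof.
elim: j => [|j IH] le; first by rewrite expr0 mulmx1.
rewrite -IH; last by rewrite (leq_trans _ le) // leq_add2l.
apply/eqP; rewrite eqn_leq exprSr -mulmxE mulmxA mxrankM_maxl /=.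
rewrite -(mulmxA (lowest_mx d)) mulmxE -exprSr.
have := lower_raise (lowest_level d) (lowest_down d) j.
set b := _ * _ => e; rewrite -(@mxrank_scale_nz _ _ _ b) -?e ?mxrankM_maxl //.
rewrite mulf_neq0 ?pnatr_eq0 // -natrM mul2n -natrB; last lia.
by rewrite -natrB ?pnatr_eq0; lia.
Qed.

(** * The spectrum of an invariant kernel *)

Section InvariantKernel.
Variables (a : F) (c : nat -> F).
Hypothesis a_gt0 : 0 < a.
Hypothesis c_gt0 : forall s, (s <= n)%N -> 0 < c s.
Hypothesis c_rec : forall s, (s < n)%N ->
  c s.+1 * (a + n%:R - s%:R) = c s * (a + 1 + s%:R).

Definition invariant_mx := kernel_mx (fun I J =>
  c #|I| * ((#|I| == #|J|)%:R * beta_moment a #|I :\: J|)).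

(** Both products are supported on the pairs with [#|J| = #|I|.+1]; there each
    side is a combination of the moments [z_m] and [z_m.+1] for
    [m = #|I :\: J|], and [beta_momentS] reduces the comparison to [c_rec]. *)
Lemma up_mx_invariant : up_mx *m invariant_mx = invariant_mx *m up_mx.
Proof.
rewrite !kernel_mxM; apply: eq_kernel_mx => I J.
under [RHS]eq_bigr do rewrite mulrC.
rewrite (sum_covers (fun K => c #|K| * (_ * beta_moment a #|K :\: J|))).
rewrite (sum_covers_r (fun K => c #|I| * (_ * beta_moment a #|I :\: K|))).
transitivity (c #|I|.+1 * ((#|I|.+1 == #|J|)%:R *
    \sum_(x | x \notin I) beta_moment a #|(x |: I) :\: J|)).
  rewrite !mulr_sumr; apply: eq_bigr => x xI.
  by rewrite cardsU1 xI.
transitivity (c #|I| * ((#|I|.+1 == #|J|)%:R *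
    \sum_(x in J) beta_moment a #|I :\: (J :\ x)|)); last first.
  rewrite !mulr_sumr; apply: eq_bigr => x xJ.
  by rewrite (cardsD1 x J) xJ eqSS.
have [IJ|] := eqVneq #|I|.+1 #|J|; last by rewrite !mul0r !mulr0.
rewrite !mul1r sum_setD_add.
(* Complementation turns removals from [J] into additions to [~: J]. *)
have -> : \sum_(x in J) beta_moment a #|I :\: (J :\ x)| =
    \sum_(x | x \notin ~: J) beta_moment a #|(x |: ~: J) :\: ~: I|.
  apply: eq_big => x; first by rewrite inE negbK.
  by move=> _; rewrite !setDE !setCI !setCK setIC [~: J :|: _]setUC.
rewrite sum_setD_add !setDE !setCU !setCK [~: J :&: I]setIC [~: I :&: J]setIC -!setDE.
have cI : (#|I :&: J| + #|I :\: J|)%N = #|I| by rewrite cardsID.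
have cJ : (#|I :&: J| + #|J :\: I|)%N = #|J| by rewrite setIC cardsID.
have cU : (#|I| + #|J :\: I| + #|~: I :\: J|)%N = n.
  rewrite -(cardsC I) -(cardsID J (~: I)) [J :\: I]setDE.
  by rewrite [~: I :&: J]setIC addnA.
have := c_rec (_ : #|I| < n)%N; rewrite -[J :&: I]setIC.
move: cI cJ cU IJ; set m := #|I :\: J|; set t := #|I :&: J|.
set k := #|~: I :\: J|; set s := #|I| => <- <- <-.
rewrite -addnS => /addnI <- cr.
have {cr} := cr ltac:(lia); rewrite !natrD.
have := beta_momentS m a_gt0.
set z0 := beta_moment a m; set z1 := beta_moment a m.+1; set c0 := c _; set c1 := c _.
rewrite -!natr1 => zr cr.
transitivity (c0 * (a + (t%:R + m%:R + (m%:R + 1) + k%:R) - (t%:R + m%:R)) * z1).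
  by rewrite zr; ring.
by rewrite cr zr; ring.
Qed.

Lemma lowest_raise_invariant d j : (d <= n)%N ->
  lowest_mx d *m up_mx ^+ j *m invariant_mx =
  (c d / (a + d%:R)) *: (lowest_mx d *m up_mx ^+ j).
Proof.
move=> dn; elim: j => [|j IH].
  rewrite expr0 mulmx1.
  rewrite (lowest_same_card (lowest_level d) (lowest_down d)).
  rewrite (beta_moment_alternating 0) // /beta_moment big_ord1 addr0.
  by rewrite mulr1n mul1r.
rewrite exprSr -mulmxE mulmxA -[LHS]mulmxA up_mx_invariant mulmxA IH.
by rewrite -scalemxAl.
Qed.

(** The raised copies of the lowest weight space lie on distinct levels, hence
    are independent, and they all belong to the same eigenspace. *)
Lemma rank_eigenspace_invariant_ge d : (d <= n./2)%N ->
  ((n.+1 - d.*2) * binomial_gap n d <=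
   \rank (eigenspace invariant_mx (c d / (a + d%:R))))%N.
Proof.
move=> dn; pose W (j : 'I_(n.+1 - d.*2)) := lowest_mx d *m up_mx ^+ j.
have dW : mxdirect (\sum_j W j).
  pose V (j : 'I_(n.+1 - d.*2)) := eigenspace level_mx (d + j)%:R.
  apply: (@mxdirect_subspaces F _ _ V W).
    by move=> j; apply/eigenspaceP; apply: raise_level (lowest_level d) _.
  apply: mxdirect_sum_eigenspace => i j _ _ /eqP.
  by rewrite eqr_nat eqn_add2l => /eqP /val_inj.
apply: (@leq_trans (\rank (\sum_j W j)%MS)); last first.
  apply/mxrankS/sumsmx_subP => j _; apply/eigenspaceP.
  by rewrite lowest_raise_invariant //; lia.
move/mxdirectP: dW => /= ->.
rewrite (eq_bigr (fun=> \rank (lowest_mx d))) => [|j _].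
  by rewrite sum_nat_const card_ord leq_mul2l rank_lowest_ge orbT.
by rewrite rank_lowest_raise // -ltnS -ltn_subRL.
Qed.

(** Consecutive eigenvalues have the ratio [(a + e) / (a + n - e)], which is
    less than [1] as long as [2 * e < n]. *)
Lemma invariant_eigenvalue_ltr d e : (d < e <= n./2)%N ->
  c e / (a + e%:R) < c d / (a + d%:R).
Proof.
move=> /andP[de en]; elim: e de en => [//|e IH]; rewrite ltnS => de en.
have step : c e.+1 / (a + e.+1%:R) < c e / (a + e%:R).
  have e0 : 0 < a + e%:R by rewrite ltr_wpDr.
  have e1 : 0 < a + e.+1%:R by rewrite ltr_wpDr.
  have ne : (e + 1 + (e + 1))%:R <= n%:R :> F by rewrite ler_nat; lia.
  rewrite !natrD in ne.
  have c1 : 0 < c e.+1 by apply: c_gt0; lia.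
  have := c_rec (_ : e < n)%N => /(_ ltac:(lia)) cr.
  rewrite ltr_pdivrMr // mulrAC ltr_pdivlMr //.
  rewrite -natr1 addrA (addrAC a) -cr.
  by rewrite ltr_pM2l //; lra.
have [->//|ne] := eqVneq d e.
apply: (lt_trans step); apply: IH; lia.
Qed.

Theorem invariant_spectrum (mu := fun d => c d / (a + d%:R)) :
  (forall b, eigenvalue invariant_mx b <->
     exists2 d, (d <= n./2)%N & b = mu d) /\
  (forall d, (d <= n./2)%N ->
     let m := ((n.+1 - d.*2) * binomial_gap n d)%N in
     \rank (eigenspace invariant_mx (mu d)) = m /\
     mup (mu d) (char_poly invariant_mx) = m).
Proof.
pose m d := ((n.+1 - d.*2) * binomial_gap n d)%N.
have mu_inj : injective (fun d : 'I_n./2.+1 => mu d).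
  move=> d e mude; apply/val_inj; have := ltn_ord d; have := ltn_ord e.
  rewrite !ltnS => le_e le_d; have [lt|lt|//] := ltngtP d e.
    have := @invariant_eigenvalue_ltr d e.
    by rewrite lt le_e -/(mu d) mude ltxx => /(_ isT).
  have := @invariant_eigenvalue_ltr e d.
  by rewrite lt le_d -/(mu d) mude ltxx => /(_ isT).
have m_le (d : 'I_n./2.+1) : (m d <= \rank (eigenspace invariant_mx (mu d)))%N.
  by apply: rank_eigenspace_invariant_ge; rewrite -ltnS.
have m_sum : (\sum_(d < n./2.+1) m d = #|{set T}|)%N.
  by rewrite sum_spectral_dimension -[RHS]cardsT -powersetT card_powerset cardsT.
have [spec rk alg] := exhaustive_eigenspaces mu_inj m_le m_sum.
have rkE d : (d <= n./2)%N -> \rank (eigenspace invariant_mx (mu d)) = m d.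
  by rewrite -ltnS => dn; have := rk (Ordinal dn).
split=> [b|d dn]; last first.
  by split; [exact: rkE|have := alg (Ordinal (dn : d < n./2.+1)%N)].
split=> [/spec[d ->]|[d dn ->]]; first by exists d => //; rewrite -ltnS.
rewrite /eigenvalue -mxrank_eq0 rkE // -lt0n muln_gt0.
apply/andP; split; first lia.
by case: d dn => [//|d] /= dn; rewrite subn_gt0 ltn_binomial.
Qed.

End InvariantKernel.

End Kernels.

(** * Euler's integral *)

Section GammaFunction.
Import numFieldNormedType.Exports.
Local Open Scope classical_set_scope.
Local Open Scope ring_scope.
Context {R : realType}.
Notation mu := (@lebesgue_measure R).
Implicit Types (x t : R) (k : nat).

Definition gamma_kernel x t : R := t `^ (x - 1) * expR (- t).

Lemma gamma_kernel_ge0 x t : 0 <= gamma_kernel x t.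
Proof. by rewrite mulr_ge0 ?powR_ge0 ?expR_ge0. Qed.

Lemma measurable_gamma_kernel x : measurable_fun setT (gamma_kernel x).
Proof.
apply: measurable_funM; first exact: measurable_powR.
by apply: measurableT_comp => //; exact: measurable_funN.
Qed.

Lemma measurable_gamma_kernel_EFin x (A : set R) :
  measurable_fun A (fun t => (gamma_kernel x t)%:E).
Proof.
by apply/measurable_EFinP; apply: measurable_funS (measurable_gamma_kernel x).
Qed.

(** The extended real integral: working with it first allows the functional
    equation to be proved before finiteness, and finiteness to be deduced from
    the functional equation. *)
Definition gamma_integral x : \bar R :=
  (\int[mu]_(t in `]0%R, +oo[) (gamma_kernel x t)%:E)%E.

Lemma GammaE x : Gamma x = fine (gamma_integral x).
Proof. by []. Qed.

(** Segments away from [0], where [t `^ (x - 1)] may be unbounded.  The upper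
    end is [k.+2] so that the segment is nondegenerate for [k = 0]. *)
Definition window k : set R := `[k.+1%:R^-1, k.+2%:R].

Lemma window_lt k : k.+1%:R^-1 < k.+2%:R :> R.
Proof.
rewrite (@le_lt_trans _ _ 1) ?ltr1n //.
by rewrite invf_le1 ?ler1n ?ltr0n.
Qed.

Lemma window_inv_gt0 k : 0 < k.+1%:R^-1 :> R.
Proof. by rewrite invr_gt0 ltr0n. Qed.

Lemma bigcup_window : \bigcup_k window k = `]0, +oo[%classic.
Proof.
apply/seteqP; split => t /=.
  move=> [k _]; rewrite /window /= !in_itv /= andbT => /andP[kt _].
  exact: lt_le_trans (window_inv_gt0 k) kt.
rewrite in_itv /= andbT => t0.
exists (maxn (Num.truncn t^-1) (Num.truncn t)) => //; rewrite /window /= in_itv /=.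
apply/andP; split.
  rewrite -[leRHS]invrK lef_pV2 ?posrE ?invr_gt0 ?ltr0n //.
  by rewrite ltW // (lt_le_trans (truncnS_gt _)) // ler_nat ltnS leq_maxl.
by rewrite ltW // (lt_le_trans (truncnS_gt _)) // ler_nat !ltnS leqW ?leq_maxr.
Qed.

Lemma nondecreasing_window : nondecreasing_seq window.
Proof.
move=> k l kl; rewrite subsetEset => t; rewrite /window /= !in_itv /= => /andP[kt tk].
apply/andP; split; last by rewrite (le_trans tk) // ler_nat !ltnS.
by rewrite (le_trans _ kt) // lef_pV2 ?posrE ?ltr0n // ler_nat ltnS.
Qed.

Lemma gamma_integral_window x :
  (\int[mu]_(t in window k) (gamma_kernel x t)%:E)%E @[k --> \oo]
  --> gamma_integral x.
Proof.
rewrite /gamma_integral -bigcup_window.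
apply: ge0_nondecreasing_set_cvg_integral.
- exact: nondecreasing_window.
- by move=> k; exact: measurable_itv.
- by move=> k; exact: measurable_gamma_kernel_EFin.
- by move=> k t _; rewrite lee_fin gamma_kernel_ge0.
Qed.

Lemma continuous_expRN : continuous (fun t : R => expR (- t)).
Proof.
by move=> t; apply: continuous_comp; [exact: continuousN|exact: continuous_expR].
Qed.

Lemma is_derive_expRN t : is_derive t 1 (fun t : R => - expR (- t)) (expR (- t)).
Proof. by apply: is_derive_eq; rewrite mulrN1 opprK. Qed.

Lemma window_gt0 k t : t \in `[k.+1%:R^-1, (k.+2%:R : R)] -> 0 < t.
Proof.
by rewrite in_itv /= => /andP[kt _]; rewrite (lt_le_trans _ kt) ?window_inv_gt0.
Qed.

Lemma derivable_window (F : R -> R) k :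
  (forall t, 0 < t -> derivable F t 1) ->
  derivable_oo_LRcontinuous F k.+1%:R^-1 k.+2%:R.
Proof.
move=> dF.
have cF t : 0 < t -> {for t, continuous F}.
  by move=> t0; apply/differentiable_continuous/derivable1_diffP/dF.
split => [t||].
- by move=> /subset_itv_oo_cc /window_gt0 /dF.
- by apply/cvg_at_right_filter/cF/window_inv_gt0.
- by apply/cvg_at_left_filter/cF; rewrite ltr0n.
Qed.

Lemma gamma_kernel_by_parts x k : 0 < x ->
  (\int[mu]_(t in window k) (gamma_kernel (x + 1) t)%:E =
   (gamma_kernel (x + 1) k.+1%:R^-1 - gamma_kernel (x + 1) k.+2%:R)%:E +
   x%:E * \int[mu]_(t in window k) (gamma_kernel x t)%:E)%E.
Proof.
move=> x0.
have dpow (p t : R) : 0 < t -> derivable (fun s : R => s `^ p) t 1.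
  by move=> t0; apply: derivable_powR; rewrite in_itv /= andbT.
have cexp : {within window k, continuous (fun t : R => expR (- t))}.
  exact/continuous_subspaceT/continuous_expRN.
have := @integration_by_parts R (fun t : R => t `^ x) (fun t => - expR (- t))
  (fun t => x * t `^ (x - 1)) (fun t => expR (- t)) _ _ (window_lt k).
rewrite (_ : (\int[mu]_(t in window k) (gamma_kernel (x + 1) t)%:E)%E =
  (\int[mu]_(t in window k) (t `^ x * expR (- t))%:E)%E); last first.
  by apply: eq_integral => t _; rewrite /gamma_kernel addrK.
move=> ->.
- rewrite /gamma_kernel !addrK.
  under eq_integral => t _ do rewrite mulrN -mulrA EFinN.
  rewrite integral_ge0N => [|t _]; last first.
    by rewrite lee_fin mulr_ge0 ?(ltW x0) //; exact: gamma_kernel_ge0.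
  rewrite oppeK; under eq_integral => t _ do rewrite EFinM.
  rewrite ge0_integralZl //; first by congr (_%:E + _)%E; rewrite !mulrN opprK addrC.
  + exact: measurable_gamma_kernel_EFin.
  + by move=> t _; rewrite lee_fin; exact: gamma_kernel_ge0.
  + by rewrite lee_fin ltW.
- apply: derivable_within_continuous => t /window_gt0 t0.
  by apply: derivableM => //; exact: dpow.
- by apply: derivable_window; exact: dpow.
- move=> t /subset_itv_oo_cc /window_gt0 t0.
  by rewrite powR_derive1 // in_itv /= andbT.
- exact: cexp.
- apply: derivable_window => t t0.
  by have [] := is_derive_expRN t.
- move=> t _ /=; rewrite derive1E.
  by have [_] := is_derive_expRN t.
Qed.

(** The exponential dominates the term of degree [n.+1] of its series. *)
Lemma gamma_kernel_le_inv x t n : 0 < t -> 1 <= t -> x <= n%:R ->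
  gamma_kernel (x + 1) t <= n.+1`!%:R / t.
Proof.
move=> t0 t1 xn; rewrite /gamma_kernel addrK expRN ler_pdivrMr ?expR_gt0 //.
rewrite (le_trans (ler_powR t1 xn)) // powR_mulrn ?(ltW t0) //.
rewrite mulrAC ler_pdivlMr // -exprSr mulrC -ler_pdivrMr ?ltr0n ?fact_gt0 //.
by rewrite (le_trans _ (expR_ge1Dxn n (ltW t0))) // lerDr.
Qed.

(** At the lower end [t `^ x] tends to [0] because [0 < x]; at the upper end the
    exponential dominates any power. *)
Lemma boundary_cvg0 x : 0 < x ->
  gamma_kernel (x + 1) k.+1%:R^-1 - gamma_kernel (x + 1) k.+2%:R @[k --> \oo]
  --> (0 : R).
Proof.
move=> x0; rewrite -[X in _ --> X](subrr (0 : R)); apply: cvgB.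
  apply: (@squeeze_cvgr _ _ _ _ (cst 0) (fun k => k.+1%:R^-1 `^ x)).
  - near=> k; rewrite gamma_kernel_ge0 /= /gamma_kernel addrK.
    by rewrite ler_piMr ?powR_ge0 // expR_le1 oppr_le0 ltW // window_inv_gt0.
  - exact: cvg_cst.
  - have := powR_cvg0 x0 => /cvg_at_rightP; apply; split.
      exact: window_inv_gt0.
    exact: cvg_harmonic.
pose m := (Num.truncn x).+1.
apply: (@squeeze_cvgr _ _ _ _ (cst 0) (fun k => m.+1`!%:R * k.+1%:R^-1)).
- near=> k; rewrite gamma_kernel_ge0 /=.
  apply: (le_trans (@gamma_kernel_le_inv x _ m _ _ _)).
  + by rewrite ltr0n.
  + by rewrite ler1n.
  + by rewrite ltW // truncnS_gt.
  + by rewrite ler_pM2l ?ltr0n ?fact_gt0 // lef_pV2 ?posrE ?ltr0n // ler_nat.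
- exact: cvg_cst.
- rewrite -[X in _ --> X](mulr0 (m.+1`!%:R : R)); apply: cvgMr.
  exact: cvg_harmonic.
Unshelve. all: by end_near. Qed.

(** Integration by parts on [window k], then [k] to infinity: the boundary terms
    vanish and both integrals converge monotonically. *)
Lemma gamma_integralS x : 0 < x ->
  gamma_integral (x + 1) = (x%:E * gamma_integral x)%E.
Proof.
move=> x0; rewrite -[RHS]add0e.
rewrite -(cvg_lim (@ereal_hausdorff R) (@gamma_integral_window (x + 1))).
apply: cvg_lim; first exact: ereal_hausdorff.
under eq_fun do rewrite gamma_kernel_by_parts //.
apply: cvgeD.
- by rewrite fin_num_adde_defr.
- by apply: cvg_EFin; [near=> k|exact: boundary_cvg0].
- by apply: cvgeZl => //; exact: gamma_integral_window.
Unshelve. all: by end_near. Qed.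

Lemma gamma_integral_ge0 x : (0 <= gamma_integral x)%E.
Proof. by apply: integral_ge0 => t _; rewrite lee_fin gamma_kernel_ge0. Qed.

Lemma gamma_integral1 : gamma_integral 1 = 1%E.
Proof.
rewrite /gamma_integral integral_itv_obnd_cbnd; last exact: measurable_gamma_kernel_EFin.
under eq_integral => t _ do rewrite /gamma_kernel subrr powRr0 mul1r.
rewrite (@ge0_continuous_FTC2y _ _ (fun t => - expR (- t)) _ 0).
- by rewrite oppr0 expR0 EFinN oppeK add0e.
- by move=> t _; exact: expR_ge0.
- exact/continuous_subspaceT/continuous_expRN.
- by rewrite -oppr0; apply: cvgN; exact: cvgr_expR.
- by move=> t _; have [] := is_derive_expRN t.
- by apply: cvg_at_right_filter; apply: cvgN; exact: continuous_expRN.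
- by move=> t _ /=; rewrite derive1E; have [_] := is_derive_expRN t.
Qed.

Lemma powR_le_1D (p t : R) : 0 <= p <= 1 -> 0 < t -> t `^ p <= 1 + t.
Proof.
move=> /andP[p0 p1] t0; have [t1|t1] := leP t 1.
  apply: (@le_trans _ _ (t `^ 0)); last by rewrite powRr0 lerDl ltW.
  by apply: ger_powR; rewrite ?t0.
apply: (@le_trans _ _ (t `^ 1)); last by rewrite powRr1 ?(ltW t0) // lerDr.
by apply: ler_powR => //; exact: ltW.
Qed.

(** The integrals at [1] and [2] are finite by the functional equation, and on
    [[1, 2]] the integrand is at most the sum of these two integrands.  The
    functional equation, valid for infinite values too, then propagates
    finiteness to all [x > 0]. *)
Lemma gamma_integral_fin_num x : 0 < x -> gamma_integral x \is a fin_num.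
Proof.
have step y : 0 < y -> (gamma_integral (y + 1) \is a fin_num) =
    (gamma_integral y \is a fin_num).
  move=> y0; rewrite gamma_integralS //.
  have := gamma_integral_ge0 y; case: (gamma_integral y) => [r _|_|//].
    by rewrite -EFinM.
  by rewrite gt0_muley // lte_fin.
have base y : 1 <= y <= 2 -> gamma_integral y \is a fin_num.
  move=> /andP[y1 y2]; rewrite ge0_fin_numE ?gamma_integral_ge0 //.
  apply: (@le_lt_trans _ _ (gamma_integral 1 + gamma_integral (1 + 1))%E); last first.
    by rewrite gamma_integralS // gamma_integral1 mul1e -EFinD ltry.
  rewrite /gamma_integral -ge0_integralD //=.
  - apply: ge0_le_integral => //=.
    + by move=> t _; rewrite lee_fin gamma_kernel_ge0.
    + exact: measurable_gamma_kernel_EFin.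
    + by apply: emeasurable_funD; exact: measurable_gamma_kernel_EFin.
    + move=> t; rewrite in_itv /= andbT => t0; rewrite -EFinD lee_fin.
      rewrite -mulrDl ler_wpM2r ?expR_ge0 // subrr powRr0 addrK powRr1 ?(ltW t0) //.
      by apply: powR_le_1D => //; lra.
  - by move=> t _; rewrite lee_fin gamma_kernel_ge0.
  - exact: measurable_gamma_kernel_EFin.
  - by move=> t _; rewrite lee_fin gamma_kernel_ge0.
  - exact: measurable_gamma_kernel_EFin.
have ge1 n : forall y, 1 <= y <= n.+2%:R -> gamma_integral y \is a fin_num.
  elim: n => [|n IH] y /andP[y1 yn]; first by apply: base; rewrite y1.
  have [y2|y2] := leP y 2; first by apply: base; rewrite y1.
  have -> : y = (y - 1) + 1 by rewrite subrK.
  rewrite step; last lra.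
  by apply: IH; rewrite lerBlDr natr1 yn andbT; lra.
move=> x0; rewrite -step //; apply: (ge1 (Num.truncn (x + 1))).
by rewrite lerDr ltW //= (le_trans (ltW (truncnS_gt _))) // ler_nat leqnSn.
Qed.

(** On [[1, 2]] the integrand is bounded below by a positive constant. *)
Lemma gamma_integral_gt0 x : 0 < x -> (0 < gamma_integral x)%E.
Proof.
move=> x0; pose c := 2^-1 * expR (- 2) : R.
have c0 : 0 < c by rewrite mulr_gt0 ?expR_gt0 // invr_gt0.
apply: (@lt_le_trans _ _ (\int[mu]_(t in `[1%R, 2%R]) (cst c%:E t))%E).
  rewrite integral_cst //= lebesgue_measure_itv /= lte_fin ltr1n -EFinD -EFinM.
  by rewrite lte_fin mulr_gt0 // subr_gt0 ltr1n.
apply: (@le_trans _ _ (\int[mu]_(t in `[1%R, 2%R]) (gamma_kernel x t)%:E)%E).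
  apply: ge0_le_integral => //=.
  - by move=> t _; rewrite lee_fin ltW.
  - exact: measurable_gamma_kernel_EFin.
  - move=> t; rewrite in_itv /= => /andP[t1 t2]; rewrite lee_fin.
    apply: ler_pM; rewrite ?invr_ge0 ?ler0n ?expR_ge0 //; last first.
      by rewrite ler_expR lerN2.
    have t0 : 0 < t by rewrite (lt_le_trans _ t1).
    apply: (@le_trans _ _ (t `^ (- 1))).
      by rewrite powR_inv1 ?(ltW t0) // lef_pV2 ?posrE.
    by apply: ler_powR => //; lra.
apply: ge0_subset_integral => //=.
- exact: measurable_gamma_kernel_EFin.
- by move=> t _; rewrite lee_fin gamma_kernel_ge0.
- by move=> t /=; rewrite !in_itv /= andbT => /andP[t1 _]; rewrite (lt_le_trans _ t1).
Qed.

Lemma GammaS x : 0 < x -> Gamma (x + 1) = x * Gamma x.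
Proof.
move=> x0; rewrite !GammaE gamma_integralS // fineM //.
exact: gamma_integral_fin_num.
Qed.

Lemma Gamma_gt0 x : 0 < x -> 0 < Gamma x.
Proof.
move=> x0; rewrite GammaE fine_gt0 // gamma_integral_gt0 //=.
by rewrite -ge0_fin_numE ?gamma_integral_ge0 // gamma_integral_fin_num.
Qed.

End GammaFunction.

(** * The matrix zeta *)

Section ZetaMatrix.
Import boot.finset.
(* Keeps unification from unfolding the integral. *)
Local Opaque Gamma.
Context {R : realType}.
Variables (n : nat) (u : R).

Lemma Gamma_rising (a : R) k : 0 < a ->
  Gamma (a + k%:R) = Gamma a * \prod_(i < k) (a + i%:R).
Proof.
move=> a0; elim: k => [|k IH]; first by rewrite addr0 big_ord0 mulr1.
rewrite -natr1 addrA GammaS ?ltr_wpDr // IH big_ord_recr /=; ring.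
Qed.

Lemma Gamma_denominators_neq0 : u < 1 ->
  [/\ Gamma (1 - u) != 0, Gamma (5 / 2 + n%:R / 2 - u) != 0
    & Gamma (2 + n%:R / 2 - u) != 0].
Proof.
move=> u1; have n0 : 0 <= n%:R :> R by [].
by split; rewrite gt_eqF //; apply: Gamma_gt0; lra.
Qed.

(** The factors of the entries that depend only on the level [s] of [I] and [J].
    [Gamma (1 - u)] appears because the remaining factor
    [1 / Gamma (2 + k - u)] is [1 / Gamma (1 - u)] divided by a rising factorial,
    which belongs to [beta_moment]. *)
Definition zeta_weight (s : nat) : R :=
  1 / 2 ^+ n * Gamma (5 / 2 - u) /
  (Gamma (5 / 2 + n%:R / 2 - u) * Gamma (2 + n%:R / 2 - u))
  * (Gamma (2 + s%:R - u) * Gamma (2 + (n%:R - s%:R) - u) / Gamma (1 - u)).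

Lemma zeta_weight_gt0 s : u < 1 -> (s <= n)%N -> 0 < zeta_weight s.
Proof.
move=> u1 sn; have n0 : 0 <= n%:R :> R by [].
have s0 : 0 <= s%:R :> R by [].
have ns : 0 <= n%:R - s%:R :> R by rewrite subr_ge0 ler_nat.
rewrite /zeta_weight; repeat first
  [apply: mulr_gt0 | rewrite invr_gt0 | apply: exprn_gt0 | apply: Gamma_gt0]; lra.
Qed.

Lemma zeta_weight_rec s : u < 1 -> (s < n)%N ->
  zeta_weight s.+1 * (1 - u + n%:R - s%:R) =
  zeta_weight s * (1 - u + 1 + s%:R).
Proof.
move=> u1 sn; have s0 : 0 <= s%:R :> R by [].
have ns : s%:R + 1 <= n%:R :> R by rewrite natr1 ler_nat.
have s1 : 0 < 2 + s%:R - u by lra.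
have ns1 : 0 < 1 - u + n%:R - s%:R by lra.
rewrite /zeta_weight.
rewrite (_ : 2 + s.+1%:R - u = 2 + s%:R - u + 1); last by rewrite -natr1; ring.
rewrite (_ : 2 + (n%:R - s.+1%:R) - u = 1 - u + n%:R - s%:R); last first.
  by rewrite -natr1; ring.
rewrite (_ : 2 + (n%:R - s%:R) - u = 1 - u + n%:R - s%:R + 1); last by ring.
rewrite (GammaS s1) (GammaS ns1).
generalize (Gamma (2 + s%:R - u)) (Gamma (1 - u + n%:R - s%:R)).
generalize (1 / 2 ^+ n * Gamma (5 / 2 - u) /
  (Gamma (5 / 2 + n%:R / 2 - u) * Gamma (2 + n%:R / 2 - u))) (Gamma (1 - u))^-1.
by move=> x1 x2 x3 x4; ring.
Qed.

(** If [I] and [J] have the same size, the three cardinals in the Gamma arguments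
    are determined by [s = #|I|], [k = #|I :\: J|] and [n]: the arguments are
    [2 + s - u], [2 + n - s - u] and [2 + k - u]. *)
Lemma zeta_invariant_mx : u < 1 ->
  zeta n u = invariant_mx 'I_n (1 - u) zeta_weight.
Proof.
move=> u1; have a0 : 0 < 1 - u by rewrite subr_gt0.
apply/matrixP => i j; rewrite !mxE.
set I := enum_val i; set J := enum_val j.
have cI : (#|I :&: J| + #|I :\: J|)%N = #|I| by rewrite cardsID.
have cJ : (#|I :&: J| + #|J :\: I|)%N = #|J| by rewrite setIC cardsID.
have cU : (#|I| + #|J :\: I| + #|~: (I :|: J)|)%N = n.
  rewrite -[RHS]card_ord -(cardsC I) -(cardsID J (~: I)) setCU -setDE addnA.
  by rewrite [J :\: I]setDE [~: I :&: J]setIC.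
rewrite /zeta_entry.
have -> : (#|I| == #|J|) = (#|J :\: I| == #|I :\: J|).
  by rewrite -cI -cJ eqn_add2l eq_sym.
case: eqP => [kE|_]; last by rewrite !mul0r !mulr0.
move: cU; rewrite -cI kE.
set t := #|I :&: J|; set k := #|I :\: J|; set o := #|~: (I :|: J)| => nE.
have -> : ((n - t - o)./2 = k)%N by lia.
have nR : n%:R = t%:R + k%:R + k%:R + o%:R :> R by rewrite -nE !natrD.
have -> : 2 + n%:R / 2 + t%:R / 2 - o%:R / 2 - u = 2 + (t + k)%:R - u.
  by rewrite nR natrD; field.
have -> : 2 + n%:R / 2 + o%:R / 2 - t%:R / 2 - u = 2 + (n%:R - (t + k)%:R) - u.
  by rewrite nR natrD; field.
have -> : 2 + n%:R / 2 - t%:R / 2 - o%:R / 2 - u = 1 - u + k.+1%:R.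
  by rewrite nR -natr1; field.
rewrite Gamma_rising // /zeta_weight /beta_moment.
have := rising_neq0 k.+1 a0; set p := \prod_(i < _) _ => p0.
have := Gamma_denominators_neq0 u1.
(* What remains is an identity of rational functions in the Gamma values. *)
generalize (Gamma (1 - u)) (Gamma (5 / 2 - u)) (Gamma (5 / 2 + n%:R / 2 - u))
  (Gamma (2 + n%:R / 2 - u)) (Gamma (2 + (t + k)%:R - u))
  (Gamma (2 + (n%:R - (t + k)%:R) - u)).
move=> x1 x2 x3 x4 x5 x6 [g1 g3 g4]; field.
by rewrite p0 g1 g4 g3 expf_neq0 ?pnatr_eq0.
Qed.

Lemma lambda_weight d : u < 1 -> lambda n u d = zeta_weight d / (1 - u + d%:R).
Proof.
move=> u1; have d0 : 0 <= d%:R :> R by [].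
have ad : 0 < 1 - u + d%:R by lra.
rewrite /lambda /zeta_weight.
rewrite (_ : 2 + (n%:R - d%:R) - u = 2 + n%:R - d%:R - u); last by ring.
rewrite (_ : 2 + d%:R - u = 1 - u + d%:R + 1); last by ring.
rewrite (_ : 1 + d%:R - u = 1 - u + d%:R); last by ring.
rewrite (GammaS ad).
have := Gamma_denominators_neq0 u1.
generalize (Gamma (1 - u)) (Gamma (5 / 2 - u)) (Gamma (5 / 2 + n%:R / 2 - u))
  (Gamma (2 + n%:R / 2 - u)) (Gamma (1 - u + d%:R)) (Gamma (2 + n%:R - d%:R - u)).
move=> x1 x2 x3 x4 x5 x6 [g1 g3 g4]; field.
by rewrite g1 g4 g3 (gt_eqF ad) expf_neq0 ?pnatr_eq0.
Qed.

End ZetaMatrix.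

Theorem theorem2 (R : realType) (n : nat) (u : R) (hn : (0 < n)%N) (hu : u < 1) :
  (forall a : R, eigenvalue (zeta n u) a <->
     exists2 d : nat, (d <= n./2)%N & a = lambda n u d) /\
  (forall d : nat, (d <= n./2)%N ->
     (\rank (eigenspace (zeta n u) (lambda n u d)))%:R = multiplicity n d /\
     (mup (lambda n u d) (char_poly (zeta n u)))%:R = multiplicity n d).
Proof.
have a0 : 0 < 1 - u by rewrite subr_gt0.
have := @invariant_spectrum _ 'I_n (1 - u) (zeta_weight n u) a0.
rewrite card_ord -(zeta_invariant_mx n hu).
move=> /(_ (fun s => @zeta_weight_gt0 _ n u s hu)).
move=> /(_ (fun s => @zeta_weight_rec _ n u s hu)) [spec mult].
split=> [a|d dn].
  by rewrite spec; split=> -[d dn ->]; exists d; rewrite ?lambda_weight.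
by have [rk alg] := mult d dn; rewrite lambda_weight // rk alg spectral_dimensionE.
Qed.
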